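(* Let $\Theta\subset\mathbb{R}^m$ be compact and let $\theta^*\in\Theta$ be the true parameter of the model described in the context. Assume: (1) $(\varepsilon_k)_{k\in\mathbb{N}}$ is a sequence of i.i.d. random variables in $\mathbb{R}^d$. (2) (Observability) If $\theta\in\Theta$ is such that $\Psi(S_\theta(t),t)=\Psi(S_{\theta^*}(t),t)$ for almost every $t\in[0,1]$, then $\theta=\theta^*$. (3) For all $t\in[0,1]$ and all $\theta\in\Theta$, $\mathbb{E}\{\Psi[S_\theta(t)+\varepsilon_1,t]\}=\Psi[S_\theta(t),t]$. (4) The map $t\mapsto \mathbb{E}(\Psi[S_{\theta^*}(t)+\varepsilon_1,t])^2$ is a finite continuous function on $[0,1]$; $$\sup_{t\in[0,1]}\mathbb{E}\left\{(\Psi[S_{\theta^*}(t)+\varepsilon_1,t])^2\,1_{(\Psi[S_{\theta^*}(t)+\varepsilon_1,t])^2>M}\right\}\to 0\quad\text{as } M\to+\infty;$$ and $(t,\theta)\mapsto\Psi[S_\theta(t),t]$ is a finite continuous function on $[0,1]\times\Theta$. For each $n$, let $\overline{\theta}_n$ be any minimizer over $\Theta$ of $$M_n(\theta)=\frac1n\sum_{k=1}^n\left(Y_k-\Psi[S_\theta(t_k),t_k]\right)^2 .$$ Then $\overline{\theta}_n$ converges in probability to $\theta^*$ as $n\to\infty$.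
   Context: Model: $(t,\theta)\mapsto S_\theta(t)$ is a known map from $[0,1]\times\Theta$ to $\mathbb{R}^d$, $(x,t)\mapsto\Psi(x,t)$ is a known function from $\mathbb{R}^d\times[0,1]$ to $\mathbb{R}$. For each $n$, the observation times are $t_k=k/n$, $k=1,\dots,n$, and one observes only $Y_1,\dots,Y_n$, where $$X_k=S_{\theta^*}(t_k)+\varepsilon_k,\qquad Y_k=\Psi(X_k,t_k)+V_k .$$ $(\varepsilon_k)_{k\in\mathbb{N}}$ is a sequence of random variables in $\mathbb{R}^d$ (trajectory noise); $(V_k)_{k\in\mathbb{N}}$ is a sequence of i.i.d. centered real random variables with known density $g$ and finite variance $\sigma^2$, independent of $(\varepsilon_k)_{k\in\mathbb{N}}$. Probabilities and expectations are under the true parameter $\theta^*$. *)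

(* Defs.v *)
From HB Require Import structures.
From mathcomp Require Import all_boot all_order all_algebra.
From mathcomp Require Import all_classical all_reals all_analysis.

Set Implicit Arguments.
Unset Strict Implicit.
Unset Printing Implicit Defensive.

Import Order.TTheory GRing.Theory Num.Theory.
Import numFieldNormedType.Exports.

Local Open Scope classical_set_scope.
Local Open Scope ring_scope.

(* R^d with its Borel sigma-algebra; the carrier is convertible to 'rV[R]_d. *)
Definition borel_rV (R : realType) (d : nat) :=
  g_sigma_algebraType (@open 'rV[R]_d).

Section Probability.
Context {disp disp' disp'' : measure_display} {Omega : measurableType disp}
  {T : measurableType disp'} {T' : measurableType disp''} {R : realType}.
Variable P : probability Omega R.

Definition mutually_independent (X : nat -> {RV P >-> T}) : Prop :=
  forall (J : seq nat) (B : nat -> set T), uniq J ->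
    (forall j, measurable (B j)) ->
    P (\bigcap_(j in [set` J]) (X j @^-1` B j)) =
      (\prod_(j <- J) P (X j @^-1` B j))%E.

Definition identically_distributed (X : nat -> {RV P >-> T}) : Prop :=
  forall (j k : nat) (B : set T), measurable B ->
    distribution P (X j) B = distribution P (X k) B.

Definition iid (X : nat -> {RV P >-> T}) : Prop :=
  mutually_independent X /\ identically_distributed X.

Definition sigma_sequence d0 (U : measurableType d0) (X : nat -> {RV P >-> U}) :
    set (set Omega) :=
  <<s \bigcup_k g_sigma_algebra_preimage (X k) >>.

Definition independent_sequences
    (X : nat -> {RV P >-> T}) (Y : nat -> {RV P >-> T'}) : Prop :=
  forall A B : set Omega, sigma_sequence X A -> sigma_sequence Y B ->
    P (A `&` B) = (P A * P B)%E.

Definition has_density (X : {RV P >-> R}) (g : R -> R) : Prop :=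
  [/\ measurable_fun setT g, (forall x, 0 <= g x) &
    forall B : set R, measurable B ->
      distribution P X B = (\int[lebesgue_measure]_(x in B) (g x)%:E)%E].

(* The [X n] need not be measurable, hence the outer measure [P^*]; when they
   are, it coincides with [P] on the events below (measurable_mu_extE).  The
   norm of 'rV[R]_m is the sup norm, equivalent to the Euclidean one. *)
Definition cvg_in_probability (m : nat) (X : nat -> Omega -> 'rV[R]_m)
    (x : 'rV[R]_m) : Prop :=
  forall e : R, 0 < e ->
    (P^*)%mu [set w | e < `|X n w - x|] @[n --> \oo] --> 0%E.

End Probability.

Definition is_minimizer (T : Type) (R : realType) (A : set T) (f : T -> R)
    (x : T) : Prop :=
  A x /\ forall y, A y -> f x <= f y.

Section Model.
Context {R : realType} {m d : nat}.
Variables (S : 'rV[R]_m -> R -> 'rV[R]_d) (Psi : 'rV[R]_d -> R -> R).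

Definition noisy_signal (Omega : Type) (theta : 'rV[R]_m)
    (xi : Omega -> 'rV[R]_d) (t : R) (w : Omega) : R :=
  Psi (S theta t + xi w) t.

Definition obs_time (n k : nat) : R := k%:R / n%:R.

Definition trajectory (Omega : Type) (theta : 'rV[R]_m)
    (eps : nat -> Omega -> 'rV[R]_d) (n k : nat) (w : Omega) : 'rV[R]_d :=
  S theta (obs_time n k) + eps k w.

Definition observation (Omega : Type) (theta : 'rV[R]_m)
    (eps : nat -> Omega -> 'rV[R]_d) (V : nat -> Omega -> R) (n k : nat)
    (w : Omega) : R :=
  Psi (trajectory theta eps n k w) (obs_time n k) + V k w.

Definition least_squares (n : nat) (y : nat -> R) (theta : 'rV[R]_m) : R :=
  n%:R^-1 * \sum_(1 <= k < n.+1)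
    (y k - Psi (S theta (obs_time n k)) (obs_time n k)) ^+ 2.

End Model.

(* Main.v *)
(* Let h (t, theta) = Psi (S_theta t) t, D_theta = h (., theta_star) - h (., theta)
   and let w_k be the total noise Y_k - h (t_k, theta_star).  A minimizer theta
   satisfies sum_k (w_k + D_theta t_k)^2 <= sum_k w_k^2, hence
     sum_k (D_theta t_k)^2 <= 2 |sum_k w_k D_theta t_k|.
   If theta is close to some theta0 != theta_star, then, by continuity and
   observability, the left-hand side is at least kappa n, and D_theta may be
   replaced by D_theta0 on the right-hand side, at a cost controlled by
   sum_k |w_k|, which is at most L n with a probability close to 1.  So
   |sum_k w_k D_theta0 t_k| >= kappa n / 4 for the fixed function D_theta0, an
   event of probability O(1/n) by Chebyshev's inequality applied separately to
   the two noises.  Finitely many such theta0 suffice, by compactness of the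
   set of the theta in Theta at distance at least e from theta_star. *)

Require Import Defs.
From HB Require Import structures.
From mathcomp Require Import all_boot all_order all_algebra.
From mathcomp Require Import all_classical all_reals all_analysis.
From mathcomp Require Import finmap measurable_realfun ring lra.

Set Implicit Arguments.
Unset Strict Implicit.
Unset Printing Implicit Defensive.

Import Order.TTheory GRing.Theory Num.Theory.
Import numFieldNormedType.Exports.

Local Open Scope classical_set_scope.
Local Open Scope ring_scope.

(** * Deterministic estimates on the observation grid *)

Lemma obs_time_itv01 (R : realType) (n k : nat) :
  (k <= n)%N -> (obs_time n k : R) \in `[0, 1].
Proof.
move=> kn; rewrite in_itv /= divr_ge0 //=.
have [->|n0] := posnP n; first by rewrite /obs_time invr0 mulr0.
by rewrite ler_pdivrMr ?ltr0n // mul1r ler_nat.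
Qed.

(* The increment of the function clamping to [a, (a + b) / 2] over a grid cell
   is at most 1 / n, and vanishes if the right end of the cell is outside of
   [a, b]; these increments telescope. *)
Lemma grid_sum_ge (R : realType) (a b c : R) (F : R -> R) (n : nat) :
  0 <= a -> a < b -> b <= 1 -> 0 <= c ->
  (forall t, 0 <= F t) -> (forall t, t \in `[a, b] -> c <= F t) ->
  2 / (b - a) <= n%:R ->
  c * ((b - a) / 2) * n%:R <= \sum_(1 <= k < n.+1) F (obs_time n k).
Proof.
move=> a0 ab b1 c0 F0 Fc nab.
have ba0 : 0 < b - a by rewrite subr_gt0.
have n0 : 0 < n%:R :> R by rewrite (lt_le_trans _ nab) // divr_gt0.
pose h : R := n%:R^-1.
have h0 : 0 < h by rewrite invr_gt0.
have hab : h <= (b - a) / 2.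
  by rewrite -[leRHS]invrK lef_pV2 ?posrE ?invr_gt0 ?divr_gt0 // invf_div.
pose b' := (a + b) / 2.
pose phi (x : R) := if x <= a then a else if b' <= x then b' else x.
have phi_step x : c * n%:R * (phi (x + h) - phi x) <= F (x + h).
  have phile : phi (x + h) - phi x <= h.
    rewrite /phi; case: (lerP (x + h) a); case: (lerP b' (x + h));
    case: (lerP x a); case: (lerP b' x); rewrite /b'; lra.
  have [xab|xab] := boolP (x + h \in `[a, b]).
    apply: le_trans (Fc _ xab); rewrite -mulrA ler_piMr //.
    by rewrite (le_trans (ler_wpM2l (ltW n0) phile)) // divff // gt_eqF.
  suff -> : phi (x + h) - phi x = 0 by rewrite mulr0.
  move: xab; rewrite /phi in_itv /= negb_and -!ltNge => /orP[xa|bx].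
    by rewrite !ifT ?subrr //; move: xa h0; lra.
  have bx' : b' <= x by rewrite /b'; move: bx hab; lra.
  have xa : a < x by move: bx'; rewrite /b'; move: ab; lra.
  by case: (lerP (x + h) a); case: (lerP b' (x + h));
    case: (lerP x a); case: (lerP b' x) => *; lra.
have -> : c * ((b - a) / 2) * n%:R =
    \sum_(0 <= k < n) c * n%:R * (phi (obs_time n k.+1) - phi (obs_time n k)).
  rewrite -mulr_sumr telescope_sumr // /obs_time mul0r divff ?gt_eqF //.
  have -> : phi 0 = a by rewrite /phi a0.
  have -> : phi 1 = b' by rewrite /phi ifF ?ifT // /b'; lra.
  by rewrite /b'; field.
rewrite [leRHS]big_add1 /= ler_sum // => k _.
have -> : obs_time n k.+1 = obs_time n k + h :> R.
  by rewrite /obs_time -[k.+1]addn1 natrD mulrDl mul1r.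
exact: phi_step.
Qed.

(** Near-covering form of compactness: around each [(t, u0)], continuity gives a product
    neighbourhood on which [h] is within [e / 2] of [h (t, u0)]. Both [(t', u)] and [(t', u0)] lie
    in it, so the triangle inequality compares their values. *)
Lemma near_uniform_closeness (R : numFieldType) (T U : topologicalType)
  (V : normedModType R) (K : set T) (A : set U) (h : T * U -> V) (u0 : U) (e : R) :
  compact K -> {within K `*` A, continuous h} -> A u0 -> 0 < e ->
  \forall u \near u0, A u -> forall t, K t -> `|h (t, u) - h (t, u0)| < e.
Proof.
move=> /compact_near_coveringP Kc hc Au0 e0.
have e20 : 0 < e / 2 by rewrite divr_gt0.
pose Q u t := A u -> K t -> `|h (t, u) - h (t, u0)| < e.
suff: \forall u \near u0, K `<=` Q u.
  by apply: filterS => u KQ Au t Kt; exact: (KQ t Kt Au Kt).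
apply: Kc => t Kt.
have /subspace_continuousP/(_ (t, u0) (conj Kt Au0)) := hc.
move=> /cvgrPdist_lt /(_ _ e20); rewrite near_withinE => hnear.
have h2 : \forall x \near (t, u0), (K `*` A) x -> `|h (t, u0) - h x| < e / 2.
  exact: hnear.
case: h2 => -[B C] /= [Bt Cu] BC.
exists (B, C) => //= -[t' u] /= [Bt' Cu'] Au Kt'.
have C0 : C u0 by exact: nbhs_singleton.
rewrite (_ : _ - _ = (h (t, u0) - h (t', u0)) - (h (t, u0) - h (t', u))).
  rewrite (le_lt_trans (ler_normB _ _)) // [ltRHS]splitr ltrD //.
    exact: (BC (t', u0)).
  exact: (BC (t', u)).
by rewrite opprB [RHS]addrC subrKA.
Qed.

(** By continuity [D0] stays away from zero on an interval around [t0], any [D] uniformly close to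
    it does too, and the grid puts a positive fraction of its points there. The constants come from
    [D0] alone, so they serve all nearby [D] at once. *)
Lemma grid_sum_sqr_ge (R : realType) (D0 : R -> R) (t0 : R) :
  {within `[0, 1], continuous D0} -> t0 \in `[0, 1] -> D0 t0 != 0 ->
  exists c kappa : R, [/\ 0 < c, 0 < kappa &
    \forall n \near \oo, forall D : R -> R,
      (forall t, t \in `[0, 1] -> `|D t - D0 t| < c) ->
      kappa * n%:R <= \sum_(1 <= k < n.+1) D (obs_time n k) ^+ 2].
Proof.
(* One third of [|D0 t0|] is lost to the variation of [D0], another to replacing [D0] by [D]; the
   last third bounds [|D|] from below. *)
move=> D0c t01 D0t0; pose c := `|D0 t0| / 3.
have c0 : 0 < c by rewrite divr_gt0 // normr_gt0.
have /subspace_continuousP/(_ t0) := D0c.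
move=> /(_ t01) /cvgrPdist_lt /(_ _ c0); rewrite near_withinE => -[r /= r0 Dr].
(* The half radius keeps [[a, b]] inside the open ball of radius [r]; clamping to [[0, 1]] leaves a
   nondegenerate interval even if [t0] is an endpoint. *)
pose a := Num.max 0 (t0 - r / 2); pose b := Num.min 1 (t0 + r / 2).
move: (t01); rewrite in_itv /= => /andP[t0_ge0 t0_le1].
have a0 : 0 <= a by rewrite /a le_max lexx.
have b1 : b <= 1 by rewrite /b ge_min lexx.
have ab : a < b.
  by rewrite /a /b lt_min !gt_max; apply/andP; split; apply/andP; split; lra.
have Dc t : t \in `[a, b] -> 2 * c <= `|D0 t|.
  rewrite in_itv /= /a /b le_min ge_max => /andP[/andP[t0' tr] /andP[t1 tr']].
  have : `|D0 t0 - D0 t| < c.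
    apply: Dr; last by rewrite /= in_itv /= t0' t1.
    by rewrite /= ltr_norml; apply/andP; split; lra.
  have := ler_dist_dist (D0 t0) (D0 t); rewrite /c => /le_lt_trans/[apply].
  by rewrite ltr_norml => /andP[_]; lra.
exists c, (c ^+ 2 * ((b - a) / 2)); split => //.
  by rewrite mulr_gt0 ?exprn_gt0 // divr_gt0 // subr_gt0.
near=> n => D DD0.
apply: (@grid_sum_ge _ a b _ (fun t => D t ^+ 2)) => //.
- exact: sqr_ge0.
- by move=> t; exact: sqr_ge0.
- move=> t tab; rewrite -[leRHS]real_normK ?num_real // ler_sqr ?nnegrE ?normr_ge0 ?(ltW c0) //.
  have t01' : t \in `[0, 1].
    move: tab; rewrite !in_itv /= => /andP[at_ tb].
    by rewrite (le_trans a0 at_) (le_trans tb b1).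
  have := ler_dist_dist (D t) (D0 t); have := DD0 _ t01'; have := Dc _ tab.
  move=> H1 H2 /le_lt_trans => /(_ _ H2).
  by rewrite ltr_norml => /andP[+ _]; lra.
- by near: n; exact: nbhs_infty_ger.
Unshelve. all: by end_near. Qed.

(** Expanding the squares bounds [kappa * N / 2] by the opposite of the cross sum of [w] and [D].
    Replacing [D] by [D0] there costs at most [c * L * N], hence at most [kappa * N / 4], and a
    quarter remains. *)
Lemma sum_cross_ge (R : realFieldType) (I : Type) (s : seq I) (w D D0 : I -> R)
  (c kappa L N : R) :
  \sum_(i <- s) (w i + D i) ^+ 2 <= \sum_(i <- s) w i ^+ 2 ->
  (forall i, `|D i - D0 i| <= c) -> \sum_(i <- s) `|w i| <= L * N ->
  0 <= c -> 0 <= N -> c * L <= kappa / 4 ->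
  kappa * N <= \sum_(i <- s) D i ^+ 2 ->
  kappa / 4 * N <= `|\sum_(i <- s) w i * D0 i|.
Proof.
move=> ls DD0 wL c0 N0 cL kD.
have E : \sum_(i <- s) (w i + D i) ^+ 2 =
    \sum_(i <- s) w i ^+ 2 + 2 * \sum_(i <- s) w i * D i +
    \sum_(i <- s) D i ^+ 2.
  by rewrite mulr_sumr -!big_split /=; apply: eq_bigr => i _; ring.
have {}E : kappa * N <= - 2 * \sum_(i <- s) w i * D i.
  by move: ls; rewrite E; lra.
have F : - \sum_(i <- s) w i * D i <= `|\sum_(i <- s) w i * D0 i| + c * (L * N).
  have -> : \sum_(i <- s) w i * D i =
      \sum_(i <- s) w i * D0 i + \sum_(i <- s) w i * (D i - D0 i).
    by rewrite -big_split /=; apply: eq_bigr => i _; ring.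
  rewrite opprD lerD //; first by rewrite -normrN ler_norm.
  rewrite (le_trans (ler_norm _)) // normrN (le_trans (ler_norm_sum _ _ _)) //.
  apply: le_trans (ler_wpM2l c0 wL); rewrite mulr_sumr ler_sum // => i _.
  by rewrite normrM mulrC ler_wpM2r.
have := ler_wpM2r N0 cL; lra.
Qed.

(** * Expectation of independent products and a weak law of large numbers *)

Section IndependentRVs.
Context (disp : measure_display) (Omega : measurableType disp) (R : realType)
  (P : probability Omega R).

Definition independent_pair d1 d2 (T1 : measurableType d1)
    (T2 : measurableType d2) (X : Omega -> T1) (Y : Omega -> T2) :=
  forall (A : set T1) (B : set T2), measurable A -> measurable B ->
    P (X @^-1` A `&` Y @^-1` B) = (P (X @^-1` A) * P (Y @^-1` B))%E.

Section ProductExpectation.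
Context d1 d2 (T1 : measurableType d1) (T2 : measurableType d2).
Variables (X : {RV P >-> T1}) (Y : {RV P >-> T2}) (f : T1 -> R) (g : T2 -> R).
Hypotheses (indep : independent_pair X Y).
Hypotheses (mf : measurable_fun setT f) (mg : measurable_fun setT g).
Hypotheses (iX : P.-integrable setT (fun w => (f (X w))%:E)).
Hypotheses (iY : P.-integrable setT (fun w => (g (Y w))%:E)).

Let m1 := distribution P X.
Let m2 := distribution P Y.
Let h (z : T1 * T2) : \bar R := (f z.1 * g z.2)%:E.

Let mXY : measurable_fun setT (fun w => (X w, Y w)).
Proof. exact: measurable_fun_pair. Qed.

Let Z : {RV P >-> (T1 * T2)%type} := mfun_Sub (mem_set mXY).

(** Independence says that the joint law and the product of the laws agree on measurable rectangles,
    and these determine the product measure. *)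
Let distributionZ (A : set (T1 * T2)) : measurable A ->
  distribution P Z A = (m1 \x m2)%E A.
Proof. by move=> mA; apply/esym/product_measure_unique. Qed.

Let mh : measurable_fun setT h.
Proof.
apply/measurable_EFinP; apply: measurable_funM.
  by apply: (measurableT_comp mf); exact: measurable_fst.
by apply: (measurableT_comp mg); exact: measurable_snd.
Qed.

Let i1 : m1.-integrable setT (EFin \o f).
Proof. by apply: integrable_pushforward => //; exact/measurable_EFinP. Qed.

Let i2 : m2.-integrable setT (EFin \o g).
Proof. by apply: integrable_pushforward => //; exact/measurable_EFinP. Qed.

(** Tonelli: the iterated integral of [|f x * g y|] factors into two finite integrals. *)
Let ih : (m1 \x m2)%E.-integrable setT h.
Proof.
apply/integrable12ltyP => //.
have mag : measurable_fun setT (fun y => `|(g y)%:E|%E).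
  by apply: measurableT_comp => //; exact/measurable_EFinP.
have maf : measurable_fun setT (fun y => `|(f y)%:E|%E).
  by apply: measurableT_comp => //; exact/measurable_EFinP.
under eq_integral => x _.
  under eq_integral => y _ do rewrite /h /= normrM EFinM.
  rewrite ge0_integralZl //=.
  over.
rewrite ge0_integralZr //=; last by apply: integral_ge0.
move: i1 i2 => /integrableP[_ f1] /integrableP[_ f2].
by apply: lte_mul_pinfty => //; [exact: integral_ge0|rewrite ge0_fin_numE ?integral_ge0].
Qed.

Lemma integrable_independentM :
  P.-integrable setT (fun w => (f (X w) * g (Y w))%:E).
Proof.
apply/integrableP; split; first exact: (measurableT_comp mh mXY).
have /integrableP[_] := ih.
rewrite (@eq_measure_integral _ _ _ _ (distribution P Z)).
  by rewrite ge0_integral_distribution //; exact: measurableT_comp.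
by move=> A mA _; exact/esym/distributionZ.
Qed.

(** Change of variables to the joint law, then Fubini for the product of the two laws. *)
Lemma integral_independentM :
  (\int[P]_w (f (X w) * g (Y w))%:E =
    (\int[P]_w (f (X w))%:E) * (\int[P]_w (g (Y w))%:E))%E.
Proof.
transitivity (\int[distribution P Z]_z h z)%E.
  by rewrite integral_distribution //; exact: integrable_independentM.
rewrite (@eq_measure_integral _ _ _ _ (m1 \x m2)%E); last first.
  by move=> A mA _; exact: distributionZ.
rewrite -integral12_prod_meas1 //.
rewrite -(integral_distribution (X := X) (f := EFin \o f)) //; last first.
  exact/measurable_EFinP.
rewrite -(integral_distribution (X := Y) (f := EFin \o g)) //; last first.
  exact/measurable_EFinP.
rewrite /fubini_F -/m1 -/m2.
under eq_integral => x _.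
  under eq_integral => y _ do rewrite /h /= EFinM.
  rewrite integralZl //.
  over.
have /fineK <- : (\int[m2]_y (g y)%:E)%E \is a fin_num.
  exact: integrable_fin_num.
by rewrite integralZr.
Qed.

End ProductExpectation.

(** Chebyshev's inequality: the cross terms of the squared sum have mean zero by independence and
    centring, so its second moment is at most [n * B ^+ 2 * C]; Markov's inequality for the square
    divides this by [(kappa * n) ^+ 2]. *)
Lemma weak_law_independent d (T : measurableType d) (n : nat)
  (X : 'I_n -> {RV P >-> T}) (f : 'I_n -> T -> R) (a : 'I_n -> R)
  (B C kappa : R) :
  (forall i j, i != j -> independent_pair (X i) (X j)) ->
  (forall i, measurable_fun setT (f i)) ->
  (forall i, P.-integrable setT (fun w => (f i (X i w))%:E)) ->
  (forall i, \int[P]_w (f i (X i w))%:E = 0)%E ->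
  (forall i, \int[P]_w (f i (X i w) ^+ 2)%:E <= C%:E)%E ->
  (forall i, `|a i| <= B) -> 0 < kappa -> (0 < n)%N ->
  (P [set w | kappa * n%:R <= `|\sum_i a i * f i (X i w)|]%R
    <= (B ^+ 2 * C / kappa ^+ 2 / n%:R)%:E)%E.
Proof.
move=> indep mf iX X0 X2 aB kappa0 n0.
have n0' : 0 < n%:R :> R by rewrite ltr0n.
pose F w := \sum_i a i * f i (X i w).
have mfX i : measurable_fun setT (fun w => f i (X i w)).
  by apply: (measurableT_comp (mf i)).
have mF : measurable_fun setT F.
  by apply: measurable_sum => i; apply: measurable_funM.
(* Off the diagonal integrability comes from independence, on the diagonal from the second moment
   bound. *)
have iXX i j : P.-integrable setT (fun w => (f i (X i w) * f j (X j w))%:E).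
  have [<-|ij] := eqVneq i j; last first.
    by apply: integrable_independentM => //; exact: indep.
  apply/integrableP; split.
    by apply/measurable_EFinP; apply: measurable_funM.
  under eq_integral => w _ do rewrite gee0_abs ?lee_fin -?expr2 ?sqr_ge0 //.
  by rewrite (le_lt_trans (X2 i)) // ltry.
have C0 : 0 <= C.
  rewrite -lee_fin; apply: le_trans (X2 (Ordinal n0)).
  by apply: integral_ge0 => w _; rewrite lee_fin sqr_ge0.
have B0 : 0 <= B by apply: le_trans (aB (Ordinal n0)).
have F2 : (\int[P]_w (F w ^+ 2)%:E <= (n%:R * (B ^+ 2 * C))%:E)%E.
  have FE w : (F w ^+ 2)%:E = (\sum_i \sum_j
      (a i * a j)%:E * (f i (X i w) * f j (X j w))%:E)%E.
    rewrite expr2 /F big_distrlr /= -sumEFin; apply: eq_bigr => i _.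
    by rewrite -sumEFin; apply: eq_bigr => j _; rewrite -EFinM mulrACA.
  under eq_integral => w _ do rewrite FE.
  rewrite integral_sum //; last first.
    by move=> i; apply: integrable_sum => // j _; exact: integrableZl.
  have -> : n%:R * (B ^+ 2 * C) = \sum_(i < n) B ^+ 2 * C.
    by rewrite sumr_const card_ord mulr_natl.
  rewrite -sumEFin; apply: lee_sum => i _.
  rewrite integral_sum //; last by move=> j; exact: integrableZl.
  rewrite (bigD1 i) //= big1 ?adde0; last first.
    move=> j ji; rewrite integralZl // integral_independentM //.
      by rewrite X0 mul0e mule0.
    by apply: indep; rewrite eq_sym.
  rewrite integralZl // [leRHS]EFinM; apply: lee_pmul.
  - by rewrite lee_fin -expr2 sqr_ge0.
  - by apply: integral_ge0 => w _; rewrite lee_fin -expr2 sqr_ge0.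
  - by rewrite lee_fin -expr2 -real_normK ?num_real // ler_sqr ?nnegrE.
  - by under eq_integral => w _ do rewrite -expr2; exact: X2.
have kn0 : 0 < kappa * n%:R by rewrite mulr_gt0.
pose FRV : {RV P >-> R} := mfun_Sub (mem_set mF).
have := @markov _ _ _ P FRV (fun x => x ^+ 2) _ kn0.
rewrite unlock => /(_ (exprn_measurable 2) (fun x _ => sqr_ge0 x)).
have sqr_homo : {in Num.nneg &, {homo (fun x : R => x ^+ 2) : x y / x <= y}}.
  by move=> x y; rewrite !nnegrE => x0 y0; rewrite ler_sqr.
move=> /(_ sqr_homo) H.
have {}H : (((kappa * n%:R) ^+ 2)%:E *
    P [set w | kappa * n%:R <= `|F w|]%R <= (n%:R * (B ^+ 2 * C))%:E)%E.
  apply: le_trans F2; apply: le_trans H _.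
  by under eq_integral => w _ do rewrite /= real_normK ?num_real //.
rewrite -lee_pdivlMl in H; last by rewrite exprn_gt0.
apply: le_trans H _; rewrite -EFinM lee_fin.
rewrite le_eqVlt; apply/orP; left; apply/eqP; field.
by rewrite !gt_eqF.
Qed.

End IndependentRVs.

(** * Localization of minimizers *)

(** Makes the event that some minimizer lies in [U] depend on the fixed weights [D u0] only, so that
    a weak law applies although the minimizer is random. The neighbourhood [U] is where [h (_, u)]
    is uniformly close to [h (_, u0)]. *)
Lemma least_squares_localization (R : realType) (T : topologicalType)
  (A : set T) (h : R * T -> R) (us u0 : T) (t0 L : R) :
  {within `[0, 1] `*` A, continuous h} -> A us -> A u0 ->
  t0 \in `[0, 1] -> h (t0, us) != h (t0, u0) -> 0 < L ->
  exists2 kappa : R, 0 < kappa & exists2 U : set T, open_nbhs u0 U &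
    \forall n \near \oo, forall (u : T) (w : 'I_n -> R), U u -> A u ->
      let D v i := h (obs_time n i.+1, us) - h (obs_time n i.+1, v) in
      \sum_i (w i + D u i) ^+ 2 <= \sum_i w i ^+ 2 ->
      \sum_i `|w i| <= L * n%:R -> kappa * n%:R <= `|\sum_i w i * D u0 i|.
Proof.
move=> hc Aus Au0 t01 hne L0.
have sliceC v : A v -> {within `[0, 1], continuous (fun t : R => h (t, v))}.
  move=> Av; apply/subspace_continuousP => t tI.
  have /subspace_continuousP/(_ (t, v) (conj tI Av)) := hc.
  apply: cvg_trans => /= V; rewrite /nbhs /= => -[[B1 B2] /= [tB1 vB2] BV].
  apply: filterS tB1 => t' tB1 t'I.
  by apply: (BV (t', v)); split => //=; exact: nbhs_singleton.
have Dc : {within `[0, 1], continuous (fun t : R => h (t, us) - h (t, u0))}.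
  by move=> t; apply: cvgB; exact: sliceC.
have D0 : h (t0, us) - h (t0, u0) != 0 by rewrite subr_eq0.
have [c [kappa [c0 kappa0 Hn]]] := grid_sum_sqr_ge Dc t01 D0.
(* Below [c], the lower bound on the sum of the [D u i ^+ 2] holds; below [kappa / 4 / L], replacing
   [D u] by [D u0] costs at most a quarter of [kappa * n]. *)
pose c' := Num.min c (kappa / 4 / L).
have c'0 : 0 < c' by rewrite lt_min c0 !divr_gt0.
have := near_uniform_closeness (@segment_compact R 0 1) hc Au0 c'0.
rewrite -nbhs_nearE nbhsE => -[U Uo UA].
exists (kappa / 4); first by rewrite divr_gt0.
exists U => //; near=> n; move=> u w Uu Au ls wL.
(* The ordinal [i] stands for observation [i.+1], since observation times start at [1 / n]. *)
pose D v (i : 'I_n) := h (obs_time n i.+1, us) - h (obs_time n i.+1, v).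
have DD t : t \in `[0, 1] ->
    `|(h (t, us) - h (t, u)) - (h (t, us) - h (t, u0))| < c'.
  move=> tI; rewrite opprB [X in `|X|](_ : _ = h (t, u0) - h (t, u)).
    by rewrite distrC; exact: UA.
  by rewrite addrC subrKA.
have tI (i : 'I_n) : (obs_time n i.+1 : R) \in `[0, 1] by exact: obs_time_itv01.
apply: (@sum_cross_ge _ _ _ w (D u) (D u0) c' kappa L) => //.
- by move=> i; apply/ltW/DD.
- exact: ltW.
- by rewrite -ler_pdivlMr // ge_min lexx orbT.
- have /(_ (fun t => h (t, us) - h (t, u))) :
      forall D : R -> R, (forall t, t \in `[0, 1] ->
        `|D t - (h (t, us) - h (t, u0))| < c) ->
      kappa * n%:R <= \sum_(1 <= k < n.+1) D (obs_time n k) ^+ 2 by near: n.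
  rewrite big_add1 big_mkord; apply => t /DD.
  by rewrite lt_min => /andP[].
Unshelve. all: by end_near. Qed.

(** * Identically distributed and independent sequences, Markov's inequality *)

Section IdenticallyDistributed.
Context (disp d : measure_display) (Omega : measurableType disp)
  (T : measurableType d) (R : realType) (P : probability Omega R)
  (X : nat -> {RV P >-> T}).
Hypothesis X_id : identically_distributed X.

(** Both sides are integrals of [f] against the same law. This and the next two lemmas carry the
    assumptions on [eps 1] over to every [eps k]. *)
Lemma ge0_integral_identically_distributed (j k : nat) (f : T -> \bar R) :
  measurable_fun setT f -> (forall x, 0 <= f x)%E ->
  (\int[P]_w f (X j w) = \int[P]_w f (X k w))%E.
Proof.
move=> mf f0.
rewrite -(ge0_integral_distribution (X j)) // -(ge0_integral_distribution (X k)) //.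
by apply: eq_measure_integral => A mA _; exact: X_id.
Qed.

Lemma integrable_identically_distributed (j k : nat) (f : T -> \bar R) :
  measurable_fun setT f -> P.-integrable setT (fun w => f (X j w)) ->
  P.-integrable setT (fun w => f (X k w)).
Proof.
move=> mf /integrableP[_ fj]; apply/integrableP; split.
  exact: (measurableT_comp mf).
rewrite (@ge0_integral_identically_distributed k j (fun x => `|f x|%E)) //.
exact: measurableT_comp.
Qed.

Lemma integral_identically_distributed (j k : nat) (f : T -> \bar R) :
  measurable_fun setT f -> P.-integrable setT (fun w => f (X j w)) ->
  (\int[P]_w f (X j w) = \int[P]_w f (X k w))%E.
Proof.
move=> mf fj; have fk := integrable_identically_distributed k mf fj.
rewrite -(integral_distribution (X := X j)) // -(integral_distribution (X := X k)) //.
by apply: eq_measure_integral => A mA _; exact: X_id.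
Qed.

End IdenticallyDistributed.

Lemma mutually_independent_pair (disp d : measure_display)
  (Omega : measurableType disp) (T : measurableType d) (R : realType)
  (P : probability Omega R) (X : nat -> {RV P >-> T}) (j k : nat) :
  mutually_independent X -> j != k -> independent_pair P (X j) (X k).
Proof.
move=> indep jk A B mA mB.
pose C i := if i == j then A else B.
have := indep [:: j; k] C; rewrite /= inE jk => /(_ isT).
rewrite !big_cons big_nil mule1 /C eqxx eq_sym (negbTE jk) => <-; last first.
  by move=> i; case: ifP.
congr (P _); apply/seteqP; split => [w [Aw Bw] i|w Cw].
  by rewrite /= !inE => /orP[] /eqP ->; rewrite ?eqxx // eq_sym (negbTE jk).
split.
  by have := Cw j; rewrite /= !inE eqxx => /(_ isT).
by have := Cw k; rewrite /= !inE eqxx orbT eq_sym (negbTE jk) => /(_ isT).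
Qed.

Lemma markov_ge0 (disp : measure_display) (Omega : measurableType disp)
  (R : realType) (P : probability Omega R) (Q : Omega -> R) (c a : R) :
  measurable_fun setT Q -> (forall w, 0 <= Q w) ->
  (\int[P]_w (Q w)%:E <= c%:E)%E -> 0 < a ->
  (P [set w | a <= Q w]%R <= (c / a)%:E)%E.
Proof.
move=> mQ Q0 Qc a0.
pose QRV : {RV P >-> R} := mfun_Sub (mem_set mQ).
have := @markov _ _ _ P QRV id _ a0.
rewrite unlock => /(_ (@measurable_id _ _ setT) (fun x => id)).
move=> /(_ (fun x y _ _ => id)) H.
have {}H : (a%:E * P [set w | a <= Q w]%R <= c%:E)%E.
  apply: le_trans Qc; apply: le_trans (le_trans H _).
    rewrite le_eqVlt; apply/orP; left; apply/eqP; congr (_ * P _)%E.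
    by apply/seteqP; split => w /=; rewrite lee_fin ger0_norm.
  by under eq_integral => w _ do rewrite /= ger0_norm //.
by rewrite -lee_pdivlMl // -EFinM mulrC in H.
Qed.

(** * Outer measure, compactness and measurability *)

(** The sets [U] for which the outer measure vanishes in the limit are stable under subsets and
    finite unions, so a finite subcover of [K] by such open sets suffices. *)
Lemma outer_measure_compact_cvg0 (R : realType) (Omega : Type)
  (T : ptopologicalType) (mu : {outer_measure set Omega -> \bar R})
  (G : nat -> set Omega) (X : nat -> Omega -> T) (K : set T) :
  compact K ->
  (forall x, K x -> exists2 U, open_nbhs x U &
    mu (G n `&` X n @^-1` U) @[n --> \oo] --> 0%E) ->
  mu (G n `&` X n @^-1` K) @[n --> \oo] --> 0%E.
Proof.
rewrite compact_cover => Kc smallK.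
pose small U := mu (G n `&` X n @^-1` U) @[n --> \oo] --> 0%E.
have small_sub U V : U `<=` V -> small V -> small U.
  move=> UV; apply: squeeze_cvge; last exact: cvg_cst.
  apply: nearW => n; rewrite outer_measure_ge0 /=.
  by apply: le_outer_measure => w [Gw /UV].
have smallU U V : small U -> small V -> small (U `|` V).
  move=> sU sV; have : (mu (G n `&` X n @^-1` U) + mu (G n `&` X n @^-1` V))%E
      @[n --> \oo] --> 0%E by rewrite -[0%E]adde0; exact: cvgeD.
  apply: squeeze_cvge; last exact: cvg_cst.
  apply: nearW => n; rewrite outer_measure_ge0 /=.
  by rewrite preimage_setU setIUr; exact: outer_measureU2.
have [||D' D's KD'] := Kc (set T) [set U | open U /\ small U] id.
- by move=> U [].
- by move=> x /smallK[U [Uo Ux] sU]; exists U.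
apply: small_sub (KD') _.
have small0 : small set0.
  rewrite /small; under eq_fun do rewrite preimage_set0 setI0 outer_measure0.
  exact: cvg_cst.
have D'small U : U \in D' -> small U by move=> /D's /set_mem[].
have -> : cover [set` D'] id = \big[setU/set0]_(U <- D') U.
  by rewrite /cover bigcup_fset.
by rewrite big_seq; apply: (big_ind small).
Qed.

Lemma cvge0_near_leP (R : realType) (u : nat -> \bar R) :
  (forall n, 0 <= u n)%E ->
  u n @[n --> \oo] --> 0%E <->
  forall e : R, 0 < e -> \forall n \near \oo, (u n <= e%:E)%E.
Proof.
move=> u0; split => [/fine_cvgP[ufin /cvgrPdist_le uc] e e0|ue].
  near=> n.
  have un : u n \is a fin_num by near: n.
  rewrite -(fineK un) lee_fin; apply: le_trans (ler_norm _) _.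
  by rewrite -normrN -[X in `|X|]add0r; near: n; exact: uc.
have ufin : \forall n \near \oo, u n \is a fin_num.
  apply: filterS (ue 1 ltr01) => n un.
  by rewrite ge0_fin_numE // (le_lt_trans un) // ltry.
apply/fine_cvgP; split => //; apply/cvgrPdist_le => e e0.
near=> n; rewrite sub0r normrN ger0_norm ?fine_ge0 // -lee_fin fineK.
  by near: n; exact: ue.
by near: n.
Unshelve. all: by end_near. Qed.

Lemma compact_continuous_norm_bound (R : realType) (T : topologicalType)
  (K : set T) (f : T -> R) :
  compact K -> {within K, continuous f} ->
  exists2 M, 0 <= M & forall x, K x -> `|f x| <= M.
Proof.
move=> Kc /continuous_compact /(_ Kc) /compact_bounded[M [_ MK]].
exists (`|M| + 1) => [|x Kx]; first by rewrite addr_ge0.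
by apply: (MK (`|M| + 1)); [rewrite (le_lt_trans (ler_norm M)) // ltrDl|exists x].
Qed.

Lemma measurable_superlevel d (T : measurableType d) (R : realType) (f : T -> R)
  (c : R) : measurable_fun setT f -> measurable [set x | c <= f x].
Proof.
move=> /(_ measurableT `[c, +oo[%classic (measurable_itv _)); rewrite setTI.
by congr measurable; apply/seteqP; split => x /=; rewrite in_itv /= andbT.
Qed.

Lemma measurable_borel_translation (R : realType) (d : nat) (s : 'rV[R]_d) :
  measurable_fun [set: borel_rV R d]
    (fun x : borel_rV R d => (s + (x : 'rV[R]_d)) : borel_rV R d).
Proof.
apply: (@measurability _ _ (borel_rV R d) (borel_rV R d) setT _
  (@open 'rV[R]_d) erefl) => _ [U Uo <-].
rewrite setTI; apply: sub_sigma_algebra.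
(* Membership in the generating class is openness in ['rV[R]_d], where translations are
   continuous. *)
have : open ((fun x : 'rV[R]_d => s + x) @^-1` U); last by [].
apply: open_comp => // x _.
by apply: continuousD; [exact: cst_continuous|by move=> ?].
Qed.

(** * Consistency of the least squares estimator *)

Theorem theorem1 (R : realType) (m d : nat)
  (disp : measure_display) (Omega : measurableType disp)
  (P : probability Omega R)
  (Theta : set 'rV[R]_m) (theta_star : 'rV[R]_m)
  (S : 'rV[R]_m -> R -> 'rV[R]_d) (Psi : 'rV[R]_d -> R -> R)
  (eps : nat -> {RV P >-> borel_rV R d}) (V : nat -> {RV P >-> R})
  (g : R -> R) (sigma : R)
  (theta_bar : nat -> Omega -> 'rV[R]_m)
  (Theta_compact : compact Theta) (theta_star_in : Theta theta_star)
  (Psi_measurable : forall t : R, t \in `[0, 1] ->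
     measurable_fun [set: borel_rV R d] (fun x : borel_rV R d => Psi x t))
  (V_iid : iid V)
  (V_centered : forall k,
     P.-integrable setT (EFin \o V k) /\ 'E_P[V k]%E = 0%E)
  (V_variance : forall k, 'V_P[V k]%E = (sigma ^+ 2)%:E)
  (V_density : forall k, has_density (V k) g)
  (V_eps_independent : independent_sequences V eps)
  (eps_iid : iid eps)
  (observability : forall theta, Theta theta ->
     {ae lebesgue_measure, forall t : R, t \in `[0, 1] ->
        Psi (S theta t) t = Psi (S theta_star t) t} ->
     theta = theta_star)
  (unbiased : forall (t : R) (theta : 'rV[R]_m), t \in `[0, 1] -> Theta theta ->
     P.-integrable setT (EFin \o noisy_signal S Psi theta (eps 1%N) t) /\
     'E_P[noisy_signal S Psi theta (eps 1%N) t]%E = (Psi (S theta t) t)%:E)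
  (moment2_finite : forall t : R, t \in `[0, 1] ->
     'E_P[fun w => (noisy_signal S Psi theta_star (eps 1%N) t w ^+ 2)%R]%E
       \is a fin_num)
  (moment2_continuous : {within `[0, 1], continuous (fun t : R =>
     fine 'E_P[fun w => (noisy_signal S Psi theta_star (eps 1%N) t w ^+ 2)%R]%E)})
  (uniform_integrability :
     (fun M : R => ereal_sup
        [set 'E_P[fun w => (noisy_signal S Psi theta_star (eps 1%N) t w ^+ 2 *
            \1_[set w' |
              M < noisy_signal S Psi theta_star (eps 1%N) t w' ^+ 2] w)%R]%E
        | t in `[0, 1]]) @ +oo --> 0%E)
  (Psi_S_continuous : {within `[0, 1] `*` Theta, continuous
     (fun p : R * 'rV[R]_m => Psi (S p.2 p.1) p.1)})
  (theta_bar_min : forall n w, (0 < n)%N ->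
     is_minimizer Theta
       (least_squares S Psi n
          (fun k => observation S Psi theta_star eps V n k w))
       (theta_bar n w)) :
  cvg_in_probability P theta_bar theta_star.
Proof.
pose h (p : R * 'rV[R]_m) := Psi (S p.2 p.1) p.1.
(* The error caused by the trajectory noise at time [t], as a function of that noise; [unbiased] at
   [theta_star] centres it. Adding [V] gives the total noise. *)
pose phi (t : R) (x : borel_rV R d) := Psi (S theta_star t + x) t - h (t, theta_star).
have unit_compact : compact (`[0, 1]%classic : set R) by exact: segment_compact.
have mphi t : t \in `[0, 1] -> measurable_fun setT (phi t).
  move=> tI; apply: measurable_funB => //.
  apply: (measurableT_comp (Psi_measurable t tI)).
  exact: measurable_borel_translation.
have [B B0 hB] := compact_continuous_norm_bound
  (compact_setX unit_compact Theta_compact) Psi_S_continuous.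
have [M M0 m2M] := compact_continuous_norm_bound unit_compact moment2_continuous.
have [_ eps_id] := eps_iid.
have [_ V_id] := V_iid.
have int_cst r : (\int[P]_w r%:E = r%:E)%E.
  by have := expectation_cst P r; rewrite unlock.
have phi_int t k : t \in `[0, 1] ->
    P.-integrable setT (fun w => (phi t (eps k w))%:E).
  move=> tI.
  apply: (integrable_identically_distributed eps_id k (j := 1%N)
    (f := EFin \o phi t)).
    by apply/measurable_EFinP; exact: mphi.
  have [iU _] := unbiased t theta_star tI theta_star_in.
  rewrite (_ : (fun _ => _) = (EFin \o noisy_signal S Psi theta_star (eps 1%N) t)
    \- cst (h (t, theta_star))%:E)%E //.
  by apply: integrableB => //; exact: finite_measure_integrable_cst.
have phi_mean t k : t \in `[0, 1] -> (\int[P]_w (phi t (eps k w))%:E = 0)%E.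
  move=> tI.
  rewrite -(integral_identically_distributed eps_id k (j := 1%N)
    (f := EFin \o phi t)) /=; last 2 first.
    by apply/measurable_EFinP; exact: mphi.
    exact: phi_int.
  have [iU] := unbiased t theta_star tI theta_star_in; rewrite unlock => EU.
  under eq_integral => w _ do rewrite /phi EFinB.
  rewrite integralB //; last exact: finite_measure_integrable_cst.
  by rewrite EU int_cst subee.
(* From [(a - b) ^+ 2 <= 2 * a ^+ 2 + 2 * b ^+ 2], with [M] bounding the second moment of the noisy
   signal and [B] the noiseless one. *)
pose C := 2 * M + 2 * B ^+ 2.
have phi_sqr t k : t \in `[0, 1] ->
    (\int[P]_w (phi t (eps k w) ^+ 2)%:E <= C%:E)%E.
  move=> tI.
  have mphi2 : measurable_fun setT (fun x => (phi t x ^+ 2)%:E).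
    by apply/measurable_EFinP; apply: measurable_funX; exact: mphi.
  rewrite (ge0_integral_identically_distributed eps_id k 1%N mphi2); last first.
    by move=> x; rewrite lee_fin sqr_ge0.
  pose U := noisy_signal S Psi theta_star (eps 1%N) t.
  have [/measurable_int/measurable_EFinP mU _] :=
    unbiased t theta_star tI theta_star_in.
  have mU2 : measurable_fun setT (fun w => (U w ^+ 2)%:E).
    by apply/measurable_EFinP; apply: measurable_funX.
  have fin2 := moment2_finite t tI.
  have U2 : (\int[P]_w (U w ^+ 2)%:E <= M%:E)%E.
    move: fin2 (m2M t tI); rewrite unlock => fin2.
    by move=> /(le_trans (ler_norm _)); rewrite -lee_fin fineK.
  apply: (@le_trans _ _ (\int[P]_w ((2%:E * (U w ^+ 2)%:E) + (2 * B ^+ 2)%:E))%E).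
    apply: ge0_le_integral => //.
    - by move=> w _; rewrite lee_fin sqr_ge0.
    - by apply: (measurableT_comp mphi2); exact: measurable_funPT.
    - by apply: emeasurable_funD => //; exact: measurable_funeM.
    - move=> w _; rewrite -EFinM -EFinD lee_fin /phi -/(U w).
      have := hB (t, theta_star) (conj tI theta_star_in).
      rewrite -/(h (t, theta_star)) => hb.
      have : h (t, theta_star) ^+ 2 <= B ^+ 2.
        by rewrite -[leLHS]real_normK ?num_real // ler_sqr ?nnegrE.
      rewrite /U /noisy_signal; move: (Psi _ _) (h _) => a b hb2.
      by have := sqr_ge0 (a + b); rewrite !expr2 in hb2 *; lra.
  rewrite ge0_integralD //; last 3 first.
  - by move=> w _; rewrite -EFinM lee_fin mulr_ge0 // sqr_ge0.
  - exact: measurable_funeM.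
  - by move=> w _; rewrite lee_fin mulr_ge0 // sqr_ge0.
  rewrite ge0_integralZl //; last by move=> w _; rewrite lee_fin sqr_ge0.
  rewrite int_cst /C [leRHS]EFinD.
  by apply: leeD => //; rewrite [leRHS]EFinM; exact: lee_wpmul2l.
have V_mean k : (\int[P]_w (V k w)%:E = 0)%E.
  by have [_] := V_centered k; rewrite unlock.
have V_int k : P.-integrable setT (fun w => (V k w)%:E).
  by have [] := V_centered k.
have V_sqr k : (\int[P]_w (V k w ^+ 2)%:E <= (sigma ^+ 2)%:E)%E.
  rewrite -(V_variance k) /variance unlock.
  have [_ ->] := V_centered k; rewrite unlock.
  rewrite le_eqVlt; apply/orP; left; apply/eqP; apply: eq_integral => w _.
  by rewrite -[RHS]/((V k w - 0) * (V k w - 0))%:E subr0 expr2.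
have indep_eps n (i j : 'I_n) : i != j -> independent_pair P (eps i.+1) (eps j.+1).
  by move=> ij; apply: mutually_independent_pair => //; case: eps_iid.
have indep_V n (i j : 'I_n) : i != j -> independent_pair P (V i.+1) (V j.+1).
  by move=> ij; apply: mutually_independent_pair => //; case: V_iid.
(* The cap [K * n] on the noise energy bounds the sum of the absolute noises, as localization
   requires; [K] stays free until Markov's inequality makes exceeding the cap unlikely. *)
have claim (K : R) (theta0 : 'rV[R]_m) : 0 < K -> Theta theta0 ->
    theta0 != theta_star ->
    exists2 U, open_nbhs theta0 U &
    (P^*)%mu ([set w | \sum_(i < n) (phi (obs_time n i.+1) (eps i.+1 w) ^+ 2 +
        V i.+1 w ^+ 2) < K * n%:R] `&` theta_bar n @^-1` U) @[n --> \oo] --> 0%E.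
  move=> K0 Ttheta0 ne0.
  (* Otherwise the two signals agree on all of [[0, 1]], and observability forces
     [theta0 = theta_star]. *)
  have [t0 t0I ht0] : exists2 t0 : R, t0 \in `[0, 1] &
      h (t0, theta_star) != h (t0, theta0).
    apply: contrapT => /forall2NP hne; move/eqP: ne0; apply.
    apply: observability => //; apply: aeW => t tI.
    by have [//|/negP/negPn/eqP] := hne t; rewrite /h /= => ->.
  have [kappa kappa0 [U Uo Hn]] := least_squares_localization
    Psi_S_continuous theta_star_in Ttheta0 t0I ht0 (addr_gt0 ltr01 K0).
  exists U => //.
  (* If the sum of two noise terms reaches [kappa * n], one of them reaches half of it. *)
  have kappa20 : 0 < kappa / 2 by rewrite divr_gt0.
  have DB n (i : 'I_n) :
      `|h (obs_time n i.+1, theta_star) - h (obs_time n i.+1, theta0)| <= 2 * B.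
    have tI : (obs_time n i.+1 : R) \in `[0, 1] by exact: obs_time_itv01.
    rewrite (le_trans (ler_normB _ _)) // mulr2n mulrDl mul1r lerD //.
      by apply: (hB (_, _)).
    by apply: (hB (_, _)).
  apply/cvge0_near_leP => [n|e e0]; first exact: outer_measure_ge0.
  pose c (C' : R) := (2 * B) ^+ 2 * C' / (kappa / 2) ^+ 2.
  near=> n.
  have n0 : (0 < n)%N by near: n; exact: nbhs_infty_gt.
  have tI (i : 'I_n) : (obs_time n i.+1 : R) \in `[0, 1] by exact: obs_time_itv01.
  pose a (i : 'I_n) := h (obs_time n i.+1, theta_star) - h (obs_time n i.+1, theta0).
  pose E1 := [set w | kappa / 2 * n%:R <=
    `|\sum_i a i * phi (obs_time n i.+1) (eps i.+1 w)|].
  pose E2 := [set w | kappa / 2 * n%:R <= `|\sum_(i < n) a i * V i.+1 w|].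
  have PE1 : (P E1 <= (c C / n%:R)%:E)%E.
    apply: (@weak_law_independent _ _ _ _ _ _ n (fun i => eps i.+1)
      (fun i => phi (obs_time n i.+1)) a (2 * B)) => //.
    - exact: indep_eps.
    - by move=> i; exact: mphi.
    - by move=> i; exact: phi_int.
    - by move=> i; exact: phi_mean.
    - by move=> i; exact: phi_sqr.
    - exact: DB.
  have PE2 : (P E2 <= (c (sigma ^+ 2) / n%:R)%:E)%E.
    apply: (@weak_law_independent _ _ _ _ _ _ n (fun i => V i.+1)
      (fun i => id) a (2 * B)) => //.
    - exact: indep_V.
    - exact: DB.
  have mE1 : measurable E1.
    apply: measurable_superlevel; apply: measurableT_comp => //.
    apply: measurable_sum => i; apply: measurable_funM => //.
    by apply: (measurableT_comp (mphi _ (tI i))).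
  have mE2 : measurable E2.
    apply: measurable_superlevel; apply: measurableT_comp => //.
    by apply: measurable_sum => i; apply: measurable_funM.
  (* Only this inclusion involves [theta_bar]; [E1] and [E2] are measurable, so their outer measure
     is their probability. *)
  apply: (@le_trans _ _ ((P^*)%mu (E1 `|` E2))).
    apply: le_outer_measure => w [/= Kw Uw].
    pose W (i : 'I_n) := phi (obs_time n i.+1) (eps i.+1 w) + V i.+1 w.
    have lsE theta : least_squares S Psi n
          (fun k => observation S Psi theta_star eps V n k w) theta =
        n%:R^-1 * \sum_i (W i +
          (h (obs_time n i.+1, theta_star) - h (obs_time n i.+1, theta))) ^+ 2.
      rewrite /least_squares big_add1 big_mkord; congr (_ * _).
      apply: eq_bigr => i _; congr (_ ^+ 2).
      by rewrite /W /phi /observation /trajectory /h /=; ring.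
    (* Minimality is tested against [theta_star], where the signal difference vanishes and only the
       squared noises remain. *)
    have [Tu /(_ _ theta_star_in)] := theta_bar_min n w n0.
    rewrite !lsE ler_pM2l ?invr_gt0 ?ltr0n //.
    under [leRHS]eq_bigr => i _ do rewrite subrr addr0.
    move=> ls.
    (* Termwise [|x + y| <= 1 + x ^+ 2 + y ^+ 2], from the squares of [x] and [y] shifted by [1/2]
       either way; this is why [L] is [1 + K]. *)
    have WK : \sum_i `|W i| <= (1 + K) * n%:R.
      rewrite mulrDl mul1r; apply: le_trans (lerD (lexx _) (ltW Kw)).
      rewrite -[X in X%:R + _]card_ord -sumr_const -big_split /=.
      apply: ler_sum => i _; rewrite /W; move: (phi _ _) (V _ _) => x y.
      rewrite ler_norml; apply/andP.
      have := sqr_ge0 (x + 1/2); have := sqr_ge0 (y + 1/2).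
      have := sqr_ge0 (x - 1/2); have := sqr_ge0 (y - 1/2).
      by rewrite !expr2; split; lra.
    have Hn' : forall (u : 'rV[R]_m) (w : 'I_n -> R), U u -> Theta u ->
      let D v i := h (obs_time n i.+1, theta_star) - h (obs_time n i.+1, v) in
      \sum_i (w i + D u i) ^+ 2 <= \sum_i w i ^+ 2 ->
      \sum_i `|w i| <= (1 + K) * n%:R ->
      kappa * n%:R <= `|\sum_i w i * D theta0 i| by near: n.
    have := Hn' _ W Uw Tu ls WK.
    rewrite (_ : \sum_i _ = \sum_i a i * phi (obs_time n i.+1) (eps i.+1 w) +
        \sum_i a i * V i.+1 w); last first.
      by rewrite -big_split; apply: eq_bigr => i _; rewrite /W /a /=; ring.
    move=> /le_trans => /(_ _ (ler_normD _ _)) HE.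
    have [?|E1w] := leP (kappa / 2 * n%:R)
      `|\sum_i a i * phi (obs_time n i.+1) (eps i.+1 w)|; first by left.
    by right; rewrite /E2 /=; lra.
  apply: le_trans (outer_measureU2 _ _ _) _.
  rewrite -(measurable_mu_extE P mE1) in PE1.
  rewrite -(measurable_mu_extE P mE2) in PE2.
  apply: le_trans (leeD PE1 PE2) _.
  rewrite -EFinD lee_fin -mulrDl ler_pdivrMr ?ltr0n // mulrC -ler_pdivrMr //.
  by near: n; exact: nbhs_infty_ger.
move=> e e0; apply/cvge0_near_leP => [n|eta eta0].
  exact: outer_measure_ge0.
(* [C2] bounds the mean of each summand of the noise energy, the extra 1 making it positive. With
   the [K] below, Markov's bound [C2 / K] equals [eta / 2]. *)
pose C2 := C + sigma ^+ 2 + 1.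
have C20 : 0 < C2.
  by rewrite ltr_wpDl // addr_ge0 ?sqr_ge0 // addr_ge0 // mulr_ge0 ?sqr_ge0.
pose K := 2 * C2 / eta.
have K0 : 0 < K by rewrite divr_gt0 // mulr_gt0.
(* The weak inequality makes this a closed part of [Theta], hence compact, and it still contains
   every point of [Theta] at distance more than [e]. *)
pose far := Theta `&` [set theta | e <= `|theta - theta_star|].
have far_compact : compact far.
  apply: compact_closedI => //.
  have -> : [set theta | e <= `|theta - theta_star|] =
      (fun theta => `|theta - theta_star|) @^-1` [set x | e <= x] by [].
  apply: closed_comp; last exact: closed_ge.
  have sub_continuous : continuous (fun theta : 'rV[R]_m => theta - theta_star).
    by move=> ?; apply: continuousB; [by move=> ?|exact: cst_continuous].
  by move=> theta _; exact: (cvg_norm (sub_continuous theta)).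
pose Q n w := \sum_(i < n) (phi (obs_time n i.+1) (eps i.+1 w) ^+ 2 +
  V i.+1 w ^+ 2).
pose smallQ n := [set w | Q n w < K * n%:R].
pose largeQ n := [set w | K * n%:R <= Q n w].
have far_local theta0 : far theta0 -> exists2 U, open_nbhs theta0 U &
    (P^*)%mu (smallQ n `&` theta_bar n @^-1` U)
      @[n --> \oo] --> 0%E.
  move=> [Ttheta0 /= e_le]; apply: claim => //.
  by apply: contraTneq e_le => ->; rewrite subrr normr0 -ltNge.
have /cvge0_near_leP far_small := outer_measure_compact_cvg0 far_compact far_local.
have eta20 : 0 < eta / 2 by rewrite divr_gt0.
near=> n.
have n0 : (0 < n)%N by near: n; exact: nbhs_infty_gt.
have n0' : 0 < n%:R :> R by rewrite ltr0n.
have tI (i : 'I_n) : (obs_time n i.+1 : R) \in `[0, 1] by exact: obs_time_itv01.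
have mQi (i : 'I_n) : measurable_fun setT (fun w =>
    phi (obs_time n i.+1) (eps i.+1 w) ^+ 2 + V i.+1 w ^+ 2).
  apply: measurable_funD; apply: measurable_funX => //.
  exact: (measurableT_comp (mphi _ (tI i))).
have mQ : measurable_fun setT (Q n) by exact: measurable_sum.
have Q0 w : 0 <= Q n w by apply: sumr_ge0 => i _; rewrite addr_ge0 ?sqr_ge0.
have QC2 : (\int[P]_w (Q n w)%:E <= (C2 * n%:R)%:E)%E.
  rewrite /Q; under eq_integral => w _ do rewrite -sumEFin.
  rewrite ge0_integral_sum //; last 2 first.
  - by move=> i; exact/measurable_EFinP.
  - by move=> i w _; rewrite lee_fin addr_ge0 ?sqr_ge0.
  rewrite -[n in leRHS]card_ord mulr_natr -sumr_const -sumEFin.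
  apply: lee_sum => i _; under eq_integral => w _ do rewrite EFinD.
  rewrite ge0_integralD //; last 4 first.
  - by move=> w _; rewrite lee_fin sqr_ge0.
  - apply/measurable_EFinP; apply: measurable_funX.
    exact: (measurableT_comp (mphi _ (tI i))).
  - by move=> w _; rewrite lee_fin sqr_ge0.
  - by apply/measurable_EFinP; exact: measurable_funX.
  apply: le_trans (leeD (phi_sqr _ _ (tI i)) (V_sqr _)) _.
  by rewrite -EFinD lee_fin /C2 lerDl.
have PQ := markov_ge0 mQ Q0 QC2 (mulr_gt0 K0 n0').
rewrite -(measurable_mu_extE P (measurable_superlevel _ mQ)) in PQ.
(* Either the noise energy reaches the cap, or the minimizer is in [far] below the cap; each event
   contributes at most [eta / 2]. *)
apply: (@le_trans _ _ ((P^*)%mu (largeQ n `|`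
    (smallQ n `&` theta_bar n @^-1` far)))).
  apply: le_outer_measure => w /= far_w.
  have [Kw|Kw] := leP (K * n%:R) (Q n w); [by left|right; split => //].
  by split; [have [] := theta_bar_min n w n0|exact: ltW].
apply: le_trans (outer_measureU2 _ _ _) _.
have Pfar : ((P^*)%mu (smallQ n `&` theta_bar n @^-1` far) <=
    (eta / 2)%:E)%E by near: n; exact: far_small.
apply: le_trans (leeD PQ Pfar) _.
rewrite -EFinD lee_fin le_eqVlt; apply/orP; left; apply/eqP.
by rewrite /K; field; rewrite !gt_eqF.
Unshelve. all: by end_near. Qed.
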